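(* Let $G=(V,E)$ be a finite strongly connected directed graph (loops and multiple arcs allowed), let $s\in V$ be a source vertex and $T\subseteq V$ a nonempty set of target vertices such that every arc leaving a vertex of $T$ ends at $s$. Fix at every vertex $v$ a rotor mechanism, i.e. an ordering $e_v^1,\dots,e_v^{d(v)}$ of the arcs leaving $v$, extended periodically to all $i\in\mathbb{Z}$ with period $d(v)$, and let $v^i$ be the head of $e_v^i$. Let $x_0=s,x_1,x_2,\dots$ be the rotor walk from $s$, i.e. the infinite sequence in which, for every vertex $v$ and every $i\ge 1$, the $i$-th occurrence of $v$ is immediately followed by $v^i$. Let $t_1,t_2,\dots$ be the hitting sequence, i.e. the subsequence of $(x_k)$ consisting of the terms lying in $T$. Then the hitting sequence is periodic: there is $D\ge 1$ with $t_{n+D}=t_n$ for all $n\ge 1$.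
   Context: $d(v)$ denotes the out-degree of $v$. The hitting sequence is infinite. ''Periodic'' means periodic from the first term on (not merely eventually periodic). *)

(* Defs.v *)
From mathcomp Require Export all_boot all_order all_algebra.

Set Implicit Arguments.
Unset Strict Implicit.
Unset Printing Implicit Defensive.

(* A finite directed multigraph is given by finite types [V] of vertices and
   [E] of arcs with [src, tgt : E -> V]; loops and parallel arcs are allowed. *)

Definition outdeg (V E : finType) (src : E -> V) (v : V) : nat :=
  #|[set a : E | src a == v]|.

Definition adjacent (V E : finType) (src tgt : E -> V) : rel V :=
  fun u v => [exists a : E, (src a == u) && (tgt a == v)].

Definition strongly_connected (V E : finType) (src tgt : E -> V) : Prop :=
  forall u v : V, connect (adjacent src tgt) u v.

(* [e v i] is the arc e_v^i: the arcs e_v^1, ..., e_v^{d(v)} list the arcs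
   leaving v, each exactly once, and i |-> e_v^i has period d(v) on all of Z. *)
Definition rotor_mechanism (V E : finType) (src : E -> V)
    (e : V -> int -> E) : Prop :=
  forall v : V,
    perm_eq [seq e v (Posz i) | i <- iota 1 (outdeg src v)]
            (enum [set a : E | src a == v])
    /\ forall i : int, e v (i + Posz (outdeg src v))%R = e v i.

(* The term [x k] is the [i]-th one, counted from 1, among those lying in
   [A]. *)
Definition occurrence (V : finType) (x : nat -> V) (A : {set V})
    (i k : nat) : Prop :=
  x k \in A /\ count (fun j => x j \in A) (iota 0 k.+1) = i.

Definition rotor_walk (V E : finType) (tgt : E -> V) (e : V -> int -> E)
    (s : V) (x : nat -> V) : Prop :=
  x 0 = s /\
  forall (v : V) (i k : nat), 1 <= i -> occurrence x [set v] i k ->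
    x k.+1 = tgt (e v (Posz i)).

(* Terms are numbered from 1, so [t 0] is irrelevant.  In particular a
   hitting sequence [t] exists only if the walk hits [T] infinitely often. *)
Definition hitting_sequence (V : finType) (x : nat -> V) (T : {set V})
    (t : nat -> V) : Prop :=
  forall n : nat, 1 <= n -> exists k : nat, occurrence x T n k /\ t n = x k.

(* Main.v *)
(** Let [u_n v] be the number of visits to [v] before the walk has left its
    [n]-th target.  The walk is then back at [s], so [u_n] is balanced: every
    vertex [v] is the head of exactly [u_n v] of the arcs used.  By pigeonhole
    there are [m] and [D > 0] such that [u_(m+D) - u_m] is at every vertex a
    multiple of the out-degree; adding this difference to any [u_n] again gives
    a balanced function, which has the same total on [T] as [u_(n+D)].  If [a]
    and [b] are balanced, then summing the balance equations over
    [P = {b < a}] shows that no arc used by [a] but not by [b] leads from [P] to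
    its complement.  Since all arcs leaving [T] lead to [s], a target in
    [{b < a}] forces [b s < a s], and one in [{a < b}] forces [a s < b s].  As
    the totals on [T] agree, [a] and [b] coincide on [T], hence
    [u_(n+D) - u_n] does not depend on [n] there. *)

Require Import Defs.
From mathcomp Require Import all_boot all_order all_algebra.
From mathcomp Require Import zify.

Set Implicit Arguments.
Unset Strict Implicit.
Unset Printing Implicit Defensive.

(** * Counting visits to sets of vertices *)

Definition visits (V : finType) (x : nat -> V) (A : {set V}) (k : nat) : nat :=
  count (fun j => x j \in A) (iota 0 k).

Lemma count_iotaS (p : pred nat) (m n : nat) :
  count p (iota m n.+1) = count p (iota m n) + p (m + n).
Proof. by rewrite -addn1 iotaD count_cat /= addn0. Qed.

Lemma visitsS (V : finType) (x : nat -> V) (A : {set V}) (k : nat) :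
  visits x A k.+1 = visits x A k + (x k \in A).
Proof. exact: count_iotaS. Qed.

Lemma visits_mono (V : finType) (x : nat -> V) (A : {set V}) (k l : nat) :
  k <= l -> visits x A k <= visits x A l.
Proof. by move/subnKC <-; rewrite /visits iotaD count_cat leq_addr. Qed.

Lemma sum_eq_mem (V : finType) (A : {set V}) (y : V) :
  \sum_(v in A) (y == v) = (y \in A).
Proof.
have [yA|yA] := boolP (y \in A).
  by rewrite (bigD1 y yA) /= eqxx big1 // => v /andP[_]; rewrite eq_sym => /negbTE ->.
by rewrite big1 // => v vA; case: eqP => // yv; rewrite yv vA in yA.
Qed.

Lemma sum_count (V : finType) (A : {set V}) (y : nat -> V) (r : seq nat) :
  \sum_(v in A) count (fun j => y j \in [set v]) r
  = count (fun j => y j \in A) r.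
Proof.
elim: r => [|j r IHr] /=; first by rewrite big1.
by rewrite big_split /= IHr -sum_eq_mem; under eq_bigr => v _ do rewrite in_set1.
Qed.

Lemma sum_visits (V : finType) (x : nat -> V) (A : {set V}) (k : nat) :
  \sum_(v in A) visits x [set v] k = visits x A k.
Proof. exact: sum_count. Qed.

(** * Balanced functions and their comparison *)

Section AbstractRotors.

Variables (V : finType) (f : V -> nat -> V).

Definition arrivals (A : {set V}) (w : V) (k : nat) : nat :=
  count (fun i => f w i \in A) (iota 1 k).

Definition balanced (a : V -> nat) : Prop :=
  forall v, a v = \sum_w arrivals [set v] w (a w).

Lemma arrivalsS (A : {set V}) (w : V) (k : nat) :
  arrivals A w k.+1 = arrivals A w k + (f w k.+1 \in A).
Proof. by rewrite /arrivals count_iotaS add1n. Qed.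

Lemma arrivalsD (A : {set V}) (w : V) (k l : nat) :
  arrivals A w (k + l)
  = arrivals A w k + count (fun i => f w i \in A) (iota k.+1 l).
Proof. by rewrite /arrivals iotaD count_cat add1n. Qed.

Lemma arrivals_mono (A : {set V}) (w : V) (k l : nat) :
  k <= l -> arrivals A w k <= arrivals A w l.
Proof. by move/subnKC <-; rewrite arrivalsD leq_addr. Qed.

Lemma arrivals_le (A : {set V}) (w : V) (k l : nat) :
  k <= l -> arrivals A w l <= arrivals A w k + (l - k).
Proof.
move=> kl; rewrite -{1}(subnKC kl) arrivalsD leq_add2l.
by rewrite -[leqRHS](size_iota k.+1) count_size.
Qed.

Lemma balanced_sum (a : V -> nat) (A : {set V}) :
  balanced a -> \sum_(v in A) a v = \sum_w arrivals A w (a w).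
Proof.
move=> bal_a; rewrite (eq_bigr _ (fun v _ => bal_a v)) exchange_big /=.
by apply: eq_bigr => w _; apply: sum_count.
Qed.

Lemma balanced_excess_closed (a b : V -> nat) (w : V) (i : nat) :
  balanced a -> balanced b -> b w < i <= a w -> b (f w i) < a (f w i).
Proof.
move=> bal_a bal_b /andP[bi ia].
pose P := [set v | b v < a v].
(* The terms in [b v] and [a v] are swapped to avoid subtraction: for [v] in [P], [L v <= R v] says
   that at most [a v - b v] of the extra arcs of [v] end in [P]. Balance makes both totals equal, so
   equality holds at each vertex. *)
pose L v := arrivals P v (a v) + (v \in P) * b v.
pose R v := arrivals P v (b v) + (v \in P) * a v.
have LR v : L v <= R v.
  rewrite /L /R inE; case: ltnP => [ba|ab]; rewrite !(mul0n, mul1n, addn0).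
    by have := arrivals_le P v (ltnW ba); lia.
  exact: arrivals_mono.
have sumP (c : V -> nat) : \sum_v (v \in P) * c v = \sum_(v in P) c v.
  by rewrite [RHS]big_mkcond; apply: eq_bigr => v _; case: ifP; rewrite ?mul1n ?mul0n.
have sumLR : \sum_v L v = \sum_v R v.
  by rewrite !big_split /= !sumP !(balanced_sum P) // addnC.
have eqLR : L w = R w.
  apply/eqP; have [_] := leqif_sum (fun v (_ : true) => leqif_eq (LR v)).
  by rewrite sumLR eqxx => /esym/forallP/(_ w).
have wP : w \in P by rewrite inE (leq_trans bi).
have ba : b w <= a w by exact: ltnW (leq_trans bi ia).
move: eqLR; rewrite /L /R wP !mul1n -{1}(subnKC ba) arrivalsD => eq_cnt.
have : all (fun j => f w j \in P) (iota (b w).+1 (a w - b w)).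
  rewrite all_count size_iota; apply/eqP; lia.
by move/allP/(_ i); rewrite mem_iota inE; apply; lia.
Qed.

Lemma balanced_eq_on_targets (T : {set V}) (s : V) (a b : V -> nat) :
  (forall v i, v \in T -> 0 < i -> f v i = s) ->
  balanced a -> balanced b -> \sum_(v in T) a v = \sum_(v in T) b v ->
  {in T, a =1 b}.
Proof.
move=> fT bal_a bal_b sumab.
have to_s (c c' : V -> nat) v : balanced c -> balanced c' -> v \in T ->
    c' v < c v -> c' s < c s.
  move=> bal_c bal_c' vT lt_cv.
  (* The arc of index [c v] is used by [c] but not by [c'], and it leads to [s]. *)
  have := balanced_excess_closed (w := v) (i := c v) bal_c bal_c'.
  by rewrite lt_cv leqnn fT ?(leq_ltn_trans _ lt_cv) //; apply.
have sum_le_eq (c c' : V -> nat) : \sum_(v in T) c v = \sum_(v in T) c' v ->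
    {in T, forall v, c v <= c' v} -> {in T, c =1 c'}.
  move=> sumc lec v vT; apply/eqP.
  have [_] := leqif_sum (fun v vT => leqif_eq (lec v vT)).
  by rewrite sumc eqxx => /esym/forallP/(_ v)/implyP/(_ vT).
case: (leqP (a s) (b s)) => [le_s|lt_s]; [apply: sum_le_eq => // v vT|].
  by rewrite leqNgt; apply/negP => /(to_s _ _ _ bal_a bal_b vT); rewrite ltnNge le_s.
move=> v vT; apply/esym; move: v vT; apply: sum_le_eq => // v vT.
rewrite leqNgt; apply/negP => /(to_s _ _ _ bal_b bal_a vT).
by rewrite ltnNge ltnW.
Qed.

(** * Full turns of the rotors *)

Variable d : V -> nat.
Hypothesis d_gt0 : forall v, 0 < d v.
Hypothesis f_periodic : forall v i, 0 < i -> f v (i + d v) = f v i.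

Lemma arrivals_period (A : {set V}) (w : V) (k q : nat) :
  arrivals A w (k + q * d w) = arrivals A w k + q * arrivals A w (d w).
Proof.
have step l : arrivals A w (l + d w) = arrivals A w l + arrivals A w (d w).
  elim: l => [|l IHl] //; rewrite addSn !arrivalsS IHl -addSn f_periodic //.
  by rewrite addnAC.
elim: q => [|q IHq]; first by rewrite !mul0n !addn0.
by rewrite mulSnr addnA step IHq mulSnr addnA.
Qed.

(** Full turns add the same arrivals wherever they start, so subtracting the balance of [a] from
    that of [b] leaves a condition on [q] alone, which can be added to the balance of [c]. *)
Lemma balanced_shift (a b c q : V -> nat) :
  balanced a -> balanced b -> balanced c ->
  (forall v, b v = a v + q v * d v) ->
  balanced (fun v => c v + q v * d v).
Proof.
move=> bal_a bal_b bal_c def_b v.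
have := bal_b v; rewrite def_b.
under eq_bigr => w _ do rewrite def_b arrivals_period.
rewrite big_split /= -bal_a => /addnI ->.
under [RHS]eq_bigr => w _ do rewrite arrivals_period.
by rewrite [RHS]big_split /= -bal_c.
Qed.

(** * Balance and recurrence of the rotor walk *)

Variables (s : V) (x : nat -> V).
Hypothesis x0 : x 0 = s.
Hypothesis xS : forall k, x k.+1 = f (x k) (visits x [set x k] k.+1).

(** Both sides count [v] among the terms [x 0] to [x k]: each term but the first is the head of the
    arc just used. *)
Lemma walk_balance (v : V) (k : nat) :
  visits x [set v] k + (x k == v)
  = (s == v) + \sum_w arrivals [set v] w (visits x [set w] k).
Proof.
elim: k => [|k IHk]; first by rewrite big1 // x0 addn0.
rewrite visitsS in_set1 IHk -addnA; congr (_ + _).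
rewrite [LHS]addnC [RHS](bigD1 (x k)) //= [in LHS](bigD1 (x k)) //=.
rewrite [X in _ = X + _](_ : _ = (x k.+1 == v)
   + arrivals [set v] (x k) (visits x [set x k] k)).
  rewrite addnA; congr (_ + _); apply: eq_bigr => w neq_w.
  by rewrite visitsS in_set1 eq_sym (negbTE neq_w) addn0.
have -> : visits x [set x k] k.+1 = (visits x [set x k] k).+1.
  by rewrite visitsS set11 addn1.
rewrite arrivalsS addnC in_set1; congr ((_ == _) + _).
by rewrite xS visitsS set11 addn1.
Qed.

Lemma balanced_visits (k : nat) :
  x k = s -> balanced (fun v => visits x [set v] k).
Proof. by move=> xk v; have := walk_balance v k; rewrite xk addnC => /addnI. Qed.

Definition rotor_step : rel V := fun u v => [exists i : 'I_(d u), f u i.+1 == v].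

(** Each full turn at [u] leads to [v] at least once. One extra turn is required because the last
    arrival may be [x k] itself, which is not yet counted. *)
Lemma visits_step (u v : V) (k M : nat) :
  rotor_step u v -> M.+1 * d u <= visits x [set u] k -> M <= visits x [set v] k.
Proof.
case/existsP => i /eqP fi Mu.
have dv : 0 < arrivals [set v] u (d u).
  rewrite -has_count; apply/hasP; exists i.+1; last by rewrite fi set11.
  by rewrite mem_iota add1n /= ltnS.
have : M.+1 <= arrivals [set v] u (visits x [set u] k).
  apply: leq_trans (arrivals_mono [set v] u Mu).
  by rewrite -[_ * _]add0n arrivals_period add0n leq_pmulr.
have := walk_balance v k; rewrite (bigD1 u) //=; case: (x k == v); lia.
Qed.

Lemma visits_connect (u v : V) :
  connect rotor_step u v ->
  forall M, exists M', forall k,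
    M' <= visits x [set u] k -> M <= visits x [set v] k.
Proof.
move=> /connectP[p]; elim: p u => [u _ -> M|w p IHp u /= /andP[uw wp] def_v M].
  by exists M.
have [M' HM'] := IHp w wp def_v M.
by exists (M'.+1 * d u) => k /(visits_step uw) /HM'.
Qed.

Lemma visits_unbounded (v : V) :
  (forall u, connect rotor_step u v) -> forall M, exists k, M <= visits x [set v] k.
Proof.
move=> conn M.
have [g Hg] := fin_all_exists (fun u => visits_connect (conn u) M).
(* The first [k] terms outnumber the sum of the thresholds, so some vertex reaches its own. *)
pose k := (\sum_u g u).+1; exists k.
have [u gu|no_u] := pickP (fun u => g u <= visits x [set u] k); first exact: Hg gu.
have : \sum_(u in [set: V]) visits x [set u] k <= \sum_u g u.
  under eq_bigl => u do rewrite in_setT.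
  by apply: leq_sum => u _; rewrite ltnW // ltnNge no_u.
rewrite sum_visits /visits (eq_count (a2 := predT)) => [|j]; last by rewrite in_setT.
by rewrite count_predT size_iota ltnn.
Qed.

(** * Hit times and periodicity of the hits *)

Variable T : {set V}.
Hypothesis fT : forall v i, v \in T -> 0 < i -> f v i = s.
Hypothesis T_unbounded : forall M, exists k, M <= visits x T k.

(* The time just after the [n]-th hit; [hit_time 0 = 0]. *)
Definition hit_time (n : nat) : nat := ex_minn (T_unbounded n).

Lemma hit_time0 : hit_time 0 = 0.
Proof. by rewrite /hit_time; case: ex_minnP => m _ /(_ 0 isT); case: m. Qed.

(** By minimality of the hit time, the term just before it is the hit. *)
Lemma hit_timeS (n : nat) :
  exists k, [/\ hit_time n.+1 = k.+1, x k \in T, visits x T k = n & hit_time n <= k].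
Proof.
rewrite /hit_time; case: ex_minnP => -[|k] // Hk mink.
have ltk : visits x T k < n.+1.
  by rewrite ltnNge; apply/negP => /mink; rewrite ltnn.
move: Hk; rewrite visitsS; case xk: (x k \in T) => Hk; last by lia.
have nk: visits x T k = n by lia.
by exists k; split => //; case: ex_minnP => m _; apply; rewrite nk.
Qed.

Lemma visits_hit_time (n : nat) : visits x T (hit_time n) = n.
Proof.
case: n => [|n]; first by rewrite hit_time0.
by have [k [-> xk <- _]] := hit_timeS n; rewrite visitsS xk addn1.
Qed.

Lemma hit_time_mono (m n : nat) : m <= n -> hit_time m <= hit_time n.
Proof.
move/subnKC <-; elim: (n - m) => [|i IHi]; first by rewrite addn0.
by rewrite addnS; have [k [-> _ _ /(leq_trans IHi) /leqW]] := hit_timeS (m + i).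
Qed.

Lemma hit_time_source (n : nat) : x (hit_time n) = s.
Proof.
case: n => [|n]; first by rewrite hit_time0.
have [k [-> xk _ _]] := hit_timeS n.
by rewrite xS fT // visitsS set11 addn1.
Qed.

Definition hit (n : nat) : V := x (hit_time n).-1.

Lemma hit_target (n : nat) : hit n.+1 \in T.
Proof. by rewrite /hit; have [k [-> ]] := hit_timeS n. Qed.

Lemma hitting_sequence_hit : hitting_sequence x T hit.
Proof.
case=> // n _; rewrite /hit; have [k [-> xk nk _]] := hit_timeS n.
exists k; split=> //; split=> //.
by rewrite -[count _ _]/(visits x T k.+1) visitsS xk nk addn1.
Qed.

Lemma visits_hitS (n : nat) (v : V) :
  v \in T ->
  visits x [set v] (hit_time n.+1) = visits x [set v] (hit_time n) + (hit n.+1 == v).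
Proof.
move=> vT; rewrite /hit; have [k [-> xk nk le_k]] := hit_timeS n.
rewrite visitsS in_set1; congr (_ + _).
(* No target is met between the two times: the total on [T] is unchanged and each single count is
   monotone. *)
have /eqP : visits x T (hit_time n) = visits x T k by rewrite visits_hit_time.
have le_visits w (_ : w \in T) := leqif_eq (visits_mono x [set w] le_k).
have [_] := leqif_sum le_visits; rewrite !sum_visits => ->.
by move/forallP/(_ v)/implyP/(_ vT)/eqP.
Qed.

Lemma visits_congruent : exists m D : nat, exists q : V -> nat, 0 < D /\
  forall v, visits x [set v] (hit_time (m + D))
            = visits x [set v] (hit_time m) + q v * d v.
Proof.
pose u n v := visits x [set v] (hit_time n).
pose B := \max_v d v.
(* The residues modulo the out-degrees are stored in one finite type, for the pigeonhole
   principle. *)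
pose r (n : nat) : {ffun V -> 'I_B.+1} := [ffun v => inord (u n v %% d v)].
pose N := #|{ffun V -> 'I_B.+1}|.+1.
have [m [D [D_gt0 eq_r]]] : exists m D, 0 < D /\ r m = r (m + D).
  have : ~~ injectiveb (fun n : 'I_N => r n).
    by apply/negP => /injectiveP /leq_card; rewrite card_ord ltnn.
  case/injectivePn => i [j neq_ij eq_r].
  have [lt_ij|lt_ji|/val_inj eq_ij] := ltngtP i j; last by rewrite eq_ij eqxx in neq_ij.
    by exists i, (j - i); rewrite subn_gt0 subnKC // ltnW.
  by exists j, (i - j); rewrite subn_gt0 subnKC // ltnW.
exists m, D, (fun v => (u (m + D) v - u m v) %/ d v); split=> // v.
have le_u : u m v <= u (m + D) v.
  by apply/visits_mono/hit_time_mono/leq_addr.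
have mod_le n : u n v %% d v < B.+1.
  by rewrite ltnS ltnW // (leq_trans (ltn_pmod _ (d_gt0 v))) // /B leq_bigmax.
have /eqP eq_mod : u (m + D) v == u m v %[mod d v].
  move/ffunP/(_ v): eq_r; rewrite !ffunE => /(congr1 val) /=.
  by rewrite !inordK // => ->.
by rewrite divnK ?subnKC // -eqn_mod_dvd //; apply/eqP.
Qed.

Lemma hit_periodic : exists D, 1 <= D /\ forall n, 1 <= n -> hit (n + D) = hit n.
Proof.
have [m [D [q [D_gt0 eq_u]]]] := visits_congruent.
have bal n := balanced_visits (hit_time_source n).
have sumT n : \sum_(v in T) visits x [set v] (hit_time n) = n.
  by rewrite sum_visits visits_hit_time.
(* The shift adds exactly [D] hits, so the shifted counts at [n] have the same total on [T] as those
   at [n + D]. *)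
have sum_q : \sum_(v in T) q v * d v = D.
  have := sumT (m + D); under eq_bigr => v _ do rewrite eq_u.
  by rewrite big_split /= sumT => /addnI.
have shift n v : v \in T -> visits x [set v] (hit_time (n + D))
    = visits x [set v] (hit_time n) + q v * d v.
  have bal_q := balanced_shift (bal m) (bal (m + D)) (bal n) eq_u.
  apply: (balanced_eq_on_targets fT (bal (n + D)) bal_q).
  by rewrite big_split /= !sumT sum_q.
exists D; split=> // -[|n] // _.
(* The shift cancels in the increment at [v = hit n.+1], so hit [n.+1 + D] also raises the count of
   [v]. *)
have vT := hit_target n.
have := visits_hitS (n + D) vT; rewrite -addSn !shift // visits_hitS // eqxx.
by case: eqP => // _; lia.
Qed.

End AbstractRotors.

(** * From arcs of the graph to abstract rotors *)

Lemma rotor_src (V E : finType) (src : E -> V) (e : V -> int -> E) (v : V) (i : nat) :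
  rotor_mechanism src e -> 0 < outdeg src v -> 0 < i -> src (e v (Posz i)) = v.
Proof.
move=> erot dv; have [perm_e per_e] := erot v.
elim/ltn_ind: i => i IHi i_gt0; have [le_i|lt_i] := leqP i (outdeg src v).
  have : e v (Posz i) \in enum [set a : E | src a == v].
    by rewrite -(perm_mem perm_e); apply: map_f; rewrite mem_iota; lia.
  by rewrite mem_enum inE => /eqP.
rewrite -(subnK (ltnW lt_i)) PoszD per_e; apply: IHi; lia.
Qed.

(** A path from [v] to the source of [a] either is trivial, and then [a] leaves [v], or begins with
    an arc leaving [v]. The arc [a] excludes the single vertex without arcs. *)
Lemma strongly_connected_outdeg (V E : finType) (src tgt : E -> V) (a : E) (v : V) :
  strongly_connected src tgt -> 0 < outdeg src v.
Proof.
move=> /(_ v (src a)) /connectP[[_ /= <-|w p /= /andP[/existsP[b /andP[/eqP <- _]] _] _]].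
  by apply/card_gt0P; exists a; rewrite inE.
by apply/card_gt0P; exists b; rewrite inE.
Qed.

Theorem theorem1 (V E : finType) (src tgt : E -> V) (s : V) (T : {set V})
  (e : V -> int -> E) (x : nat -> V)
  (Gconn : strongly_connected src tgt)
  (Tne : T != set0)
  (Tsrc : forall a : E, src a \in T -> tgt a = s)
  (erot : rotor_mechanism src e)
  (xwalk : rotor_walk tgt e s x) :
  exists t : nat -> V,
    hitting_sequence x T t /\
    exists D : nat, 1 <= D /\ forall n : nat, 1 <= n -> t (n + D) = t n.
Proof.
pose f v i := tgt (e v (Posz i)); pose d := outdeg src.
(* Any value of [e] serves as the required arc; the index 0 is arbitrary. *)
have d_gt0 v : 0 < d v := strongly_connected_outdeg (e s (Posz 0)) v Gconn.
have f_per v i : 0 < i -> f v (i + d v) = f v i.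
  by move=> _; rewrite /f PoszD (erot v).2.
have [x0 xnext] := xwalk.
have xS k : x k.+1 = f (x k) (visits x [set x k] k.+1).
  apply: xnext; first by rewrite visitsS set11 addn1.
  by split; first exact: set11.
have fT v i : v \in T -> 0 < i -> f v i = s.
  by move=> vT i_gt0; apply: Tsrc; rewrite rotor_src // d_gt0.
have sub_step : subrel (adjacent src tgt) (rotor_step f d).
  move=> u v /existsP[a /andP[su /eqP <-]].
  have : a \in enum [set b | src b == u] by rewrite mem_enum inE.
  rewrite -(perm_mem (erot u).1) => /mapP[i]; rewrite mem_iota => /andP[i_gt0 le_i] def_a.
  have lt_i : i.-1 < d u by rewrite /d; lia.
  by apply/existsP; exists (Ordinal lt_i); rewrite /= prednK // /f def_a.
have [v0 v0T] := set0Pn _ Tne.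
have T_unb M : exists k, M <= visits x T k.
  have [|k Mk] := visits_unbounded f_per x0 xS (v := v0) _ M.
    by move=> u; apply: connect_sub (Gconn u v0) => y z /sub_step /connect1.
  by exists k; rewrite -sum_visits (bigD1 v0 v0T) /= (leq_trans Mk) ?leq_addr.
exists (hit T_unb); split; first exact: hitting_sequence_hit.
exact: (hit_periodic d_gt0 f_per x0 xS fT T_unb).
Qed.
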